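(* $\mathfrak{rr}'=\mathrm{non}(\mathcal M)$.
   Context: $\mathrm{Sym}(\omega)$ is the set of permutations of $\omega$. A real series $\sum_n a_n$ is potentially conditionally convergent (p.c.c.) if there is $\pi\in\mathrm{Sym}(\omega)$ such that $\sum_n a_{\pi(n)}$ is conditionally convergent; equivalently, $a_n\to0$, $\sum\{a_n:a_n\ge0\}=+\infty$ and $\sum\{a_n:a_n\le0\}=-\infty$. A series diverges by oscillation if the $\liminf$ of its partial sums is strictly smaller than their $\limsup$ (in $[-\infty,+\infty]$). $\mathfrak{rr}'$ is the smallest cardinality of a family $\Pi\subseteq\mathrm{Sym}(\omega)$ such that for every p.c.c. series with $\sum_n a_n\in\mathbb R\cup\{\pm\infty\}$ there is $\pi\in\Pi$ such that $\sum_n a_{\pi(n)}\ne\sum_n a_n$, where the possibility that $\sum_n a_{\pi(n)}$ diverges by oscillation is allowed. $\mathrm{non}(\mathcal M)$ is the least size of a nonmeager set of reals. *)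

(* Defs.v *)
From HB Require Import structures.
From mathcomp Require Import all_boot all_order all_algebra.
From mathcomp Require Import all_classical all_reals all_analysis.

Set Implicit Arguments.
Unset Strict Implicit.
Unset Printing Implicit Defensive.

Import Order.TTheory GRing.Theory Num.Theory.
Import numFieldNormedType.Exports.

Local Open Scope classical_set_scope.
Local Open Scope ring_scope.
Local Open Scope card_scope.

Definition Sym_omega : set (nat -> nat) := [set p | bijective p].

Section Series.
Context {R : realType}.
Implicit Types (a : nat -> R) (l : \bar R).

Definition conditionally_convergent a :=
  cvgn (series a) /\ ~ cvgn [normed series a].

Definition pcc a :=
  exists2 p, Sym_omega p & conditionally_convergent (a \o p).

Definition has_sum a l := EFin (series a n) @[n --> \oo] --> l.

Definition diverges_by_oscillation a :=
  (limn_einf (EFin \o series a) < limn_esup (EFin \o series a))%E.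

End Series.

Definition rr'_family (R : realType) (Pi : set (nat -> nat)) :=
  Pi `<=` Sym_omega /\
  forall (a : nat -> R) (l : \bar R), pcc a -> has_sum a l ->
    exists2 p, Pi p &
      diverges_by_oscillation (a \o p) \/
      exists2 l', has_sum (a \o p) l' & l' <> l.

Definition nowhere_dense (T : topologicalType) (A : set T) :=
  interior (closure A) = set0.

Definition meager (T : topologicalType) (A : set T) :=
  exists F : nat -> set T,
    (forall n, nowhere_dense (F n)) /\ A `<=` \bigcup_n F n.

Definition nonmeager (T : topologicalType) (A : set T) := ~ meager A.

(* The library has no type of cardinals, only the relations #<= and #=, so the
   least cardinality of a set satisfying P is represented by a set [A] that
   attains it. *)
Definition least_card (T : Type) (P : set T -> Prop) (A : set T) :=
  P A /\ forall B : set T, P B -> A #<= B.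

Definition is_rr' (R : realType) (Pi : set (nat -> nat)) :=
  least_card (rr'_family R) Pi.

Definition is_non_M (R : realType) (X : set R) := least_card (@nonmeager R) X.

(* Main.v *)
Require Import Defs.
From mathcomp Require Import all_boot all_order all_algebra.
From mathcomp Require Import all_classical all_reals all_analysis.
From mathcomp Require Import zify lra.

(** Both inequalities are proved by moving sets of permutations to sets of reals
    and back; a nonmeager set of least cardinality exists, and it is then also
    the cardinality of a smallest family of permutations.

    From a nonmeager set X to a family of size at most |X|
    ([nonmeager_to_rr'_family]).  The binary digits of a real are read as
    instructions that list natural numbers one after the other.  Every finite
    list of instructions can be continued so as to list any chosen new numbers,
    so a real outside a suitable meager set lists every number, that is, it
    gives a permutation.  As the positive terms of a p.c.c. series have infinite
    sum and so have the negative ones, the partial sums along that permutation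
    are moreover unbounded in both directions, still outside a meager set.  X
    is not contained in this meager set, so some point of X makes the series
    oscillate.

    From a family Pi to a nonmeager set of size at most |Pi|
    ([rr'_family_to_nonmeager]).  The engine is a series with sum +oo
    ([block_series]).  The natural numbers are cut into finite blocks, each of
    which contains one negative term -1/(k+1), at c_k, and otherwise the terms
    2/(k+1).  A rearrangement that meets, in almost all blocks, some positive
    term before c_k still has sum +oo.  Hence Pi has an element p for which,
    infinitely often, c_k is the p-first element of its block
    ([rr'_family_hits_intervals]).  This is used twice.

    First, with c_k at the end of a very long block: it forces p to postpone
    small numbers for a long time, and so Pi, seen as a family of growth rates,
    is unbounded ([rr'_family_unbounded]): for each r in Pi there is a partition
    of the natural numbers into intervals, and for every Q some r in Pi has
    infinitely many intervals [n, n') with n' >= Q n.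

    Second, with c_k coding a word of bits: the elements of [2^n, 2^n') code, by
    their bits at the places in [n, n'), the words on [n, n'), and the p-first
    element is a prediction of such a word.  Each pair (p, r) in Pi * Pi thereby
    defines a 0-1 sequence, which on each interval of the partition of r is the
    word predicted by p.  A meager set is covered by nowhere dense sets that are
    avoided, up to the n-th one, by all reals whose binary digits on [n, Q n)
    form a certain word w_n ([nowhere_dense_blocks]).  Choose r with infinitely
    many intervals that are long with respect to Q, and then p that predicts w_n
    on infinitely many of those ([rr'_family_matches]).  The real of the pair
    (p, r) escapes the meager set, so the reals of all the pairs form a nonmeager
    set.

    The pairs are no more numerous than Pi, since the square of an infinite
    cardinal is that cardinal ([card_setX_le]). *)

Set Implicit Arguments.
Unset Strict Implicit.
Unset Printing Implicit Defensive.

Import Order.TTheory GRing.Theory Num.Theory.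
Import numFieldNormedType.Exports.

Local Open Scope classical_set_scope.
Local Open Scope ring_scope.
Local Open Scope card_scope.

(** * Comparing cardinals *)

Lemma card_le_injP (T : Type) (U : pointedType) (A : set T) (B : set U) :
  (A #<= B) <-> exists f : T -> U,
    (forall x, A x -> B (f x)) /\
    (forall x y, A x -> A y -> f x = f y -> x = y).
Proof.
split=> [/pcard_leP/injfunPex[f fAB fi]|[f [fAB fi]]].
  exists f; split=> // x y Ax Ay; apply: fi; exact: mem_set.
apply/pcard_leP/injfunPex; exists f => // x y /set_mem Ax /set_mem Ay.
exact: fi.
Qed.

(** Cardinals are well ordered.  Consider sets of selectors g, where g B is in B
    for each B satisfying P, such that distinct selectors of the set differ on
    every B.  A maximal such set must exhaust the values in some A, otherwise a
    selector with new values everywhere could be added; it then matches A with a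
    part of any other B. *)
Lemma least_card_exists (T : pointedType) (P : set T -> Prop) (B0 : set T) :
  P B0 -> exists A, least_card P A.
Proof.
move=> PB0.
pose Q (S : set (set T -> T)) :=
  (forall g, S g -> forall B, P B -> B (g B)) /\
  (forall g h, S g -> S h -> forall B, P B -> g B = h B -> g = h).
have [|S [[Ssel Sinj] Smax]] := @Zorn_bigcup _ Q.
  move=> F FQ Ftot; split.
    by move=> g [S FS Sg]; apply: (FQ _ FS).1.
  move=> g h [S FS Sg] [S' FS' S'h].
  have [SS'|SS'] := Ftot _ _ FS FS'.
    by apply: (FQ _ FS').2 => //; exact: SS'.
  by apply: (FQ _ FS).2 => //; exact: SS'.
have [A PA AS] : exists2 A, P A & forall x, A x -> exists2 g, S g & g A = x.
  apply: contrapT => nA.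
  have /choice[g0 g0P] : forall B, exists x, P B ->
      B x /\ forall g, S g -> g B <> x.
    move=> B; have [PB|nPB] := pselect (P B); last by exists point => /nPB.
    apply: contrapT => nx; apply: nA; exists B => // x Bx.
    apply: contrapT => ng; apply: nx; exists x => _; split=> // g Sg gBx.
    by apply: ng; exists g.
  apply: (Smax (S `|` [set g0])).
    split; first by left.
    move=> /(_ g0 (or_intror erefl)) Sg0.
    exact: (g0P _ PB0).2 Sg0 erefl.
  split=> [g [Sg|->] B PB|g h [Sg|->] [Sh|->] B PB //].
  - exact: Ssel Sg _ PB.
  - by have [] := g0P _ PB.
  - exact: Sinj Sg Sh _ PB.
  - by move/((g0P _ PB).2 _ Sg).
  - by move/esym/((g0P _ PB).2 _ Sh).
exists A; split=> // B PB.
have /choice[f fP] : forall x, exists g, A x -> S g /\ g A = x.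
  move=> x; have [Ax|nAx] := pselect (A x); last by exists (fun=> point).
  by have [g Sg gA] := AS _ Ax; exists g.
apply/card_le_injP; exists (fun x => f x B); split=> [x Ax|x y Ax Ay fxy].
  by apply: (Ssel _ _ B PB); have [] := fP _ Ax.
have [Sx <-] := fP _ Ax; have [Sy <-] := fP _ Ay.
by rewrite (Sinj _ _ Sx Sy B PB fxy).
Qed.

Lemma card_le_total (T : pointedType) (A B : set T) : A #<= B \/ B #<= A.
Proof.
have [|C [[->|->] Cle]] := @least_card_exists T (fun X => X = A \/ X = B) A.
- by left.
- by left; apply: Cle; right.
- by right; apply: Cle; left.
Qed.

Section Hessenberg.
Variables (T : pointedType) (A : set T).
Implicit Types G : set ((T * T) * T).

(** A partial pairing function is handled through its graph G, so that unions of
    chains are plain unions.  The domain of the function is the square of its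
    diagonal [diag G], which must also contain the values. *)
Definition diag G : set T := [set x | exists z, G ((x, x), z)].

Definition pairing G :=
  [/\ forall p p' z z', G (p, z) -> G (p', z') -> (p = p' <-> z = z'),
      forall x y, diag G x -> diag G y -> exists z, G ((x, y), z),
      forall x y z, G ((x, y), z) -> [/\ diag G x, diag G y & diag G z] &
      diag G `<=` A].

Lemma pairing_bigcup (F : set (set ((T * T) * T))) :
  F `<=` pairing -> total_on F subset -> pairing (\bigcup_(G in F) G).
Proof.
move=> FP Ftot.
have up (p q : (T * T) * T) :
    (\bigcup_(G in F) G) p -> (\bigcup_(G in F) G) q ->
    exists G, [/\ F G, G p & G q].
  move=> [G FG Gp] [G' FG' G'q]; have [GG'|GG'] := Ftot _ _ FG FG'.
    by exists G'; split=> //; exact: GG'.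
  by exists G; split=> //; exact: GG'.
have dg G : F G -> diag G `<=` diag (\bigcup_(G in F) G).
  by move=> FG x [z Gz]; exists z; exists G.
split.
- move=> p p' z z' Gp Gp'; have [G [FG {}Gp {}Gp']] := up _ _ Gp Gp'.
  by have [+ _ _ _] := FP _ FG; apply.
- move=> x y [z Gx] [t Gy]; have [G [FG {}Gx {}Gy]] := up _ _ Gx Gy.
  have [_ + _ _] := FP _ FG.
  by move=> /(_ x y)[||u Gu]; [exists z|exists t|exists u; exists G].
- move=> x y z [G FG Gxy]; have [_ _ + _] := FP _ FG.
  by move=> /(_ _ _ _ Gxy)[? ? ?]; split; exact: (dg _ FG).
- move=> x [z [G FG Gx]]; have [_ _ _] := FP _ FG; apply; by exists z.
Qed.

Lemma pairing_nat : infinite_set A ->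
  exists G, pairing G /\ infinite_set (diag G).
Proof.
move=> /infiniteP/card_le_injP[f [fA fI]].
have /card_le_injP[g [_ gI]] : [set: nat * nat] #<= [set: nat].
  by have := card_nat2; rewrite card_eq_le => /andP[].
pose G : set ((T * T) * T) :=
  [set p | exists m n, p = ((f m, f n), f (g (m, n)))].
have dG : diag G = range f.
  apply/seteqP; split=> [x [z [m [n [-> _ _]]]]|_ [m _ <-]]; first by exists m.
  by exists (f (g (m, m))); exists m, m.
have {}fI m n : f m = f n -> m = n by apply: fI.
have {}gI p q : g p = g q -> p = q by apply: gI.
exists G; split; last first.
  rewrite dG; apply/infiniteP/card_le_injP; exists f.
  by split=> [m _|m n _ _ /fI//]; exists m.
rewrite /pairing dG; split.
- move=> p p' z z' [m [n [-> ->]]] [m' [n' [-> ->]]]; split.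
    by case=> /fI -> /fI ->.
  by move=> /fI/gI[-> ->].
- move=> _ _ [m _ <-] [n _ <-]; exists (f (g (m, n))); by exists m, n.
- by move=> x y z [m [n [-> -> ->]]]; split; eexists.
- by move=> _ [m _ <-]; exact: fA.
Qed.

Lemma pairing_fun G : pairing G -> exists h : T -> T -> T,
  (forall x y, diag G x -> diag G y -> diag G (h x y)) /\
  (forall x y x' y', diag G x -> diag G y -> diag G x' -> diag G y' ->
     h x y = h x' y' -> x = x' /\ y = y').
Proof.
move=> [Gf Gt Gd _].
have /choice[h hP] : forall p : T * T, exists z,
    diag G p.1 -> diag G p.2 -> G (p, z).
  move=> [x y]; have [[Dx Dy]|nD] := pselect (diag G x /\ diag G y).
    by have [z Gz] := Gt _ _ Dx Dy; exists z.
  by exists point => /= ? ?; case: nD.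
exists (fun x y => h (x, y)); split.
- move=> x y Dx Dy; have /= Gh := hP (x, y) Dx Dy.
  by have [] := Gd _ _ _ Gh.
- move=> x y x' y' Dx Dy Dx' Dy' hh.
  have /= Gh := hP (x, y) Dx Dy; have /= Gh' := hP (x', y') Dx' Dy'.
  by have [] := (Gf _ _ _ _ Gh Gh').2 hh.
Qed.

(** If the complement of D := diag G contains a copy E of D, then the new pairs of
    the square of the union of D and E can be coded in E: a pair is given by two
    elements of D and two tags, which G packs into a single element of D. *)
Lemma pairing_extend G : pairing G -> infinite_set (diag G) ->
  diag G #<= A `\` diag G ->
  exists G', [/\ pairing G', G `<=` G' & ~ G' `<=` G].
Proof.
move=> PG Dinf /card_le_injP[i [iA iI]].
have [h [hD hI]] := pairing_fun PG.
have [Gf Gt Gd GA] := PG.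
set D := diag G in Dinf iA iI hD hI Gd Gt GA *.
have [d0 Dd0] : D !=set0 by exact: infinite_setN0.
have [d1 [Dd1 d10]] : (D `\` [set d0]) !=set0.
  apply: infinite_setN0; apply: infinite_setD => //; exact: finite_set1.
pose E := i @` D.
have DE x : D x -> E x -> False.
  by move=> Dx [y Dy yx]; have [_] := iA _ Dy; rewrite yx.
(* Elements of D and of its copy E are told apart by a tag d0 or d1. *)
have [r [t [rD tD rI]]] : exists r t : T -> T,
  [/\ forall x, (D `|` E) x -> D (r x), forall x, (D `|` E) x -> D (t x) &
    forall x y, (D `|` E) x -> (D `|` E) y -> r x = r y -> t x = t y -> x = y].
  have /choice[r rP] : forall x, exists y,
      (D x -> y = x) /\ (E x -> D y /\ i y = x).
    move=> x; have [Dx|nDx] := pselect (D x).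
      by exists x; split=> // Ex; case: (DE x).
    have [[y Dy yx]|nEx] := pselect (E x).
      by exists y; split.
    by exists x; split.
  exists r, (fun x => if `[< D x >] then d0 else d1); split.
  - by move=> x [Dx|Ex]; [rewrite (rP x).1|have [] := (rP x).2 Ex].
  - by move=> x _; case: ifP.
  - move=> x y xD yD rxy.
    case: asboolP => [Dx|nDx]; case: asboolP => [Dy|nDy].
    + by move: rxy; rewrite (rP x).1 // (rP y).1.
    + by move=> d01; case: d10.
    + by move=> d01; case: d10.
    + case: xD => // Ex; case: yD => // Ey _.
      have [_ <-] := (rP x).2 Ex; have [_ <-] := (rP y).2 Ey.
      by rewrite rxy.
pose k x y := h (h (r x) (r y)) (h (t x) (t y)).
have kD x y : (D `|` E) x -> (D `|` E) y -> D (k x y).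
  by move=> Ex Ey; apply: (hD); apply: (hD); auto.
have kI x y x' y' : (D `|` E) x -> (D `|` E) y -> (D `|` E) x' ->
    (D `|` E) y' -> k x y = k x' y' -> x = x' /\ y = y'.
  move=> Ex Ey Ex' Ey' e.
  have [er et] := hI _ _ _ _ (hD _ _ (rD _ Ex) (rD _ Ey))
    (hD _ _ (tD _ Ex) (tD _ Ey)) (hD _ _ (rD _ Ex') (rD _ Ey'))
    (hD _ _ (tD _ Ex') (tD _ Ey')) e.
  have [rx ry] := hI _ _ _ _ (rD _ Ex) (rD _ Ey) (rD _ Ex') (rD _ Ey') er.
  have [tx ty] := hI _ _ _ _ (tD _ Ex) (tD _ Ey) (tD _ Ex') (tD _ Ey') et.
  by split; apply: rI.
pose N : set ((T * T) * T) := [set p | [/\ (D `|` E) p.1.1, (D `|` E) p.1.2,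
  ~ (D p.1.1 /\ D p.1.2) & p.2 = i (k p.1.1 p.1.2)]].
have dN : diag (G `|` N) = D `|` E.
  apply/seteqP; split=> x.
    by move=> [z [Gz|[]//]]; left; exists z.
  move=> DEx; have [Dx|nDx] := pselect (D x).
    by have [z Gz] := Gt _ _ Dx Dx; exists z; left.
  by exists (i (k x x)); right; split=> //= -[].
exists (G `|` N); split; last first.
- have Eid : E (i d0) by exists d0.
  move=> sub; have /Gd[Di _ _] : G ((i d0, i d0), i (k (i d0) (i d0))).
    by apply: (sub (_, _)); right; split=> //=;
      [right|right|move=> [Di _]; exact: (DE _ Di)].
  exact: (DE _ Di).
- by move=> p; left.
rewrite /pairing dN; split.
- have GN p p' z z' : G (p, z) -> N (p', z') -> (p = p' <-> z = z').
    case: p => x y; case: p' => x' y' /Gd[Dx Dy Dz] /= [/= Ex Ey nD ->].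
    split=> [[xx yy]|zi]; first by case: nD; rewrite -xx -yy.
    by case: (DE z) => //; rewrite zi; exists (k x' y') => //; exact: kD.
  move=> p p' z z' [Gp|Np] [Gp'|Np'].
  + exact: Gf.
  + exact: GN.
  + by have [a b] := GN _ _ _ _ Gp' Np; split=> ?; apply/esym; [apply: a|apply: b].
  + case: p Np => x y [/= Ex Ey _ ->]; case: p' Np' => x' y' [/= Ex' Ey' _ ->].
    split=> [[-> ->]//|/iI ik].
    by have [] := kI _ _ _ _ Ex Ey Ex' Ey' (ik (kD _ _ Ex Ey)
      (kD _ _ Ex' Ey')) => -> ->.
- move=> x y Ex Ey; have [[Dx Dy]|nD] := pselect (D x /\ D y).
    by have [z Gz] := Gt _ _ Dx Dy; exists z; left.
  by exists (i (k x y)); right; split.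
- move=> x y z [/Gd[? ? ?]|[/= Ex Ey _ ->]]; first by split; left.
  by split=> //; right; exists (k x y) => //; exact: kD.
- move=> x [/GA//|[y Dy <-]]; by have [] := iA _ Dy.
Qed.

(** Hessenberg's theorem.  Take a maximal pairing function, with domain D * D, above
    one on a countable subset of A, so that D is infinite.  By maximality the
    complement of D in A does not contain a copy of D, so it embeds into D.  Hence A
    embeds into D * D and then into D, and A * A into D * D, hence into D. *)
Lemma card_setX_le : infinite_set A -> A `*` A #<= A.
Proof.
move=> /pairing_nat[G0 [PG0 inf0]].
have [F FP Ftot|G [PG Gmax]] := @Zorn_bigcup _ (fun G => pairing (G0 `|` G)).
  have [->|/set0P[G1 FG1]] := eqVneq F set0; first by rewrite bigcup_set0 setU0.
  have -> : G0 `|` \bigcup_(G in F) G = \bigcup_(G in [set G0 `|` G | G in F]) G.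
    rewrite bigcup_image; apply/seteqP; split=> [p|p [G FG]].
      by move=> [G0p|[G FG Gp]]; [exists G1 => //; left|exists G => //; right].
    by move=> [G0p|Gp]; [left|right; exists G].
  apply: pairing_bigcup => [_ [G FG <-]|_ _ [G FG <-] [G' FG' <-]]; first exact: FP.
  by have [GG'|GG'] := Ftot _ _ FG FG'; [left|right]; apply: setUS.
set G1 := G0 `|` G in PG.
have G1inf : infinite_set (diag G1).
  apply: sub_infinite_set inf0 => x [z G0z]; exists z; by left.
have [h [hD hI]] := pairing_fun PG.
have [DA|AD] := @card_le_total T (diag G1) (A `\` diag G1).
  have [G' [PG' GG' nG']] := pairing_extend PG G1inf DA.
  exfalso; apply: (Gmax G').
    split=> [p Gp|G'G]; first by apply: GG'; right.
    by apply: nG' => p G'p; right; exact: G'G.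
  by rewrite setUidr // => p G0p; apply: GG'; left.
have [_ _ _ DA] := PG.
have [d0 Dd0] : diag G1 !=set0 by exact: infinite_setN0.
have [d1 [Dd1 d10]] : (diag G1 `\` [set d0]) !=set0.
  apply: infinite_setN0; apply: infinite_setD => //; exact: finite_set1.
have /card_le_injP[j [jD jI]] := AD.
have {}jD x : A x -> ~ diag G1 x -> diag G1 (j x) by move=> *; exact: jD.
have {}jI x y : A x -> ~ diag G1 x -> A y -> ~ diag G1 y -> j x = j y -> x = y.
  by move=> *; exact: jI.
pose e x := if `[< diag G1 x >] then h d0 x else h d1 (j x).
have eD x : A x -> diag G1 (e x).
  by move=> Ax; rewrite /e; case: asboolP => nx; apply: hD; auto.
have eI x y : A x -> A y -> e x = e y -> x = y.
  move=> Ax Ay; rewrite /e; case: asboolP => nx; case: asboolP => ny exy.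
  - by have [] := hI _ _ _ _ Dd0 nx Dd0 ny exy.
  - have [d01 _] := hI _ _ _ _ Dd0 nx Dd1 (jD _ Ay ny) exy; by case: d10.
  - have [d01 _] := hI _ _ _ _ Dd1 (jD _ Ax nx) Dd0 ny exy; by case: d10.
  - have [_] := hI _ _ _ _ Dd1 (jD _ Ax nx) Dd1 (jD _ Ay ny) exy; exact: jI.
apply/card_le_injP; exists (fun p => h (e p.1) (e p.2)); split.
  by move=> [x y] [/= Ax Ay]; apply/DA/hD; exact: eD.
move=> [x y] [x' y'] [/= Ax Ay] [/= Ax' Ay'] exy.
have [ex ey] := hI _ _ _ _ (eD _ Ax) (eD _ Ay) (eD _ Ax') (eD _ Ay') exy.
by rewrite (eI _ _ Ax Ax' ex) (eI _ _ Ay Ay' ey).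
Qed.
End Hessenberg.

(** * Rearranging to a convergent series *)

Lemma inj_surj_bijective (f : nat -> nat) :
  injective f -> (forall y, exists x, f x = y) -> bijective f.
Proof.
move=> fI /choice[g fg]; exists g => // x.
by apply: fI; rewrite fg.
Qed.

Section Greedy.
Variables (R : realType) (u v : nat -> R).
Hypotheses (u0 : forall n, 0 <= u n) (v0 : forall n, 0 <= v n).
Hypotheses (uoo : forall M, exists n, M < series u n).
Hypotheses (voo : forall M, exists n, M < series v n).

(** Riemann's greedy merge of the positive terms u and the negative terms - v: the
    state counts the terms used so far, and the next term pushes the partial sum S
    back towards 0. *)
Fixpoint greedy n : nat * nat :=
  if n is n'.+1 then
    let: (i, j) := greedy n' in
    if series u i <= series v j then (i.+1, j) else (i, j.+1)
  else (0, 0)%N.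

Let i n := (greedy n).1.
Let j n := (greedy n).2.
Let S n := series u (i n) - series v (j n).

Lemma greedyS n : (S n <= 0 /\ i n.+1 = (i n).+1 /\ j n.+1 = j n) \/
  (0 < S n /\ i n.+1 = i n /\ j n.+1 = (j n).+1).
Proof.
rewrite /S /i /j /=; case: (greedy n) => a b /=.
by case: ifP; rewrite subr_le0 subr_gt0 => h; [left|right; rewrite ltNge h].
Qed.

Lemma greedy_mono n m : (n <= m)%N -> (i n <= i m)%N /\ (j n <= j m)%N.
Proof.
elim: m => [|m IH]; first by rewrite leqn0 => /eqP ->.
rewrite leq_eqVlt => /predU1P[->//|/IH].
by case: (greedyS m) => [[_ [-> ->]]|[_ [-> ->]]]; lia.
Qed.

Lemma greedy_nonpos n : exists2 m, (n <= m)%N & S m <= 0.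
Proof.
apply: contrapT => nex.
have pos m : (n <= m)%N -> 0 < S m.
  by move=> nm; rewrite ltNge; apply/negP => Sm; apply: nex; exists m.
have ij k : i (n + k)%N = i n /\ j (n + k)%N = (j n + k)%N.
  elim: k => [|k [IHi IHj]]; first by rewrite !addn0.
  rewrite !addnS; case: (greedyS (n + k)) => [[]|[_ [-> ->]]].
    by rewrite leNgt pos // leq_addr.
  by rewrite IHi IHj.
have [k] := voo (series u (i n)).
have /pos : (n <= n + k)%N by exact: leq_addr.
rewrite /S; have [-> ->] := ij k; rewrite subr_gt0 => /lt_trans lt /lt.
rewrite ltNge => /negP; apply.
rewrite addnC; apply: (@nondecreasing_series _ _ predT) => //; exact: leq_addr.
Qed.

Lemma greedy_pos n : exists2 m, (n <= m)%N & 0 < S m.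
Proof.
apply: contrapT => nex.
have neg m : (n <= m)%N -> S m <= 0.
  by move=> nm; rewrite leNgt; apply/negP => Sm; apply: nex; exists m.
have ij k : i (n + k)%N = (i n + k)%N /\ j (n + k)%N = j n.
  elim: k => [|k [IHi IHj]]; first by rewrite !addn0.
  rewrite !addnS; case: (greedyS (n + k)) => [[_ [-> ->]]|[]].
    by rewrite IHi IHj.
  by rewrite ltNge neg // leq_addr.
have [k] := uoo (series v (j n)).
have /neg : (n <= n + k)%N by exact: leq_addr.
rewrite /S; have [-> ->] := ij k; rewrite subr_le0 => le /(le_lt_trans le).
rewrite ltNge => /negP; apply.
rewrite addnC; apply: (@nondecreasing_series _ _ predT) => //; exact: leq_addr.
Qed.

Lemma greedy_unbounded K : exists n, (K <= i n)%N /\ (K <= j n)%N.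
Proof.
elim: K => [|K [n [iK jK]]]; first by exists 0%N.
have [m nm Sm] := greedy_nonpos n; have [m' nm' Sm'] := greedy_pos n.
have iS : i m.+1 = (i m).+1.
  by case: (greedyS m) => [[_ []//]|[]]; rewrite ltNge Sm.
have jS : j m'.+1 = (j m').+1.
  by case: (greedyS m') => [[]|[_ []//]]; rewrite leNgt Sm'.
exists (maxn m.+1 m'.+1).
have [i1 _] := greedy_mono (leq_maxl m.+1 m'.+1).
have [_ j1] := greedy_mono (leq_maxr m.+1 m'.+1).
by have := greedy_mono nm; have := greedy_mono nm'; lia.
Qed.

(** Once only terms of size at most e remain, a sign change of S leaves
    |S| <= e, and no later step leaves that range. *)
Lemma greedy_cvg : u @ \oo --> 0 -> v @ \oo --> 0 -> S @ \oo --> 0.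
Proof.
move=> /cvgrPdist_le cu /cvgrPdist_le cv; apply/cvgrPdist_le => e e0.
have [Nu _ hu] := cu _ e0; have [Nv _ hv] := cv _ e0.
have {hu}hu n : (Nu <= n)%N -> u n <= e.
  by move=> /hu /=; rewrite sub0r normrN ger0_norm.
have {hv}hv n : (Nv <= n)%N -> v n <= e.
  by move=> /hv /=; rewrite sub0r normrN ger0_norm.
have [n0 [iN jN]] := greedy_unbounded (maxn Nu Nv).
have stepP n : (n0 <= n)%N ->
  (S n <= 0 /\ S n <= S n.+1 <= S n + e) \/ (0 < S n /\ S n - e <= S n.+1 <= S n).
  move=> /greedy_mono[i1 j1].
  have hui : u (i n) <= e by apply: hu; lia.
  have hvj : v (j n) <= e by apply: hv; lia.
  have := u0 (i n); have := v0 (j n).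
  case: (greedyS n) => [[Sn [ei ej]]|[Sn [ei ej]]] vj ui; [left|right]; split=> //.
    by move: Sn; rewrite /S ei ej seriesSr; lra.
  by move: Sn; rewrite /S ei ej seriesSr; lra.
have [n1 n01 Sn1] := greedy_nonpos n0.
have [n2 n12 /andP[Sn2 Sn2e]] : exists2 n2, (n1 <= n2)%N & 0 < S n2 <= e.
  have [m n1m Sm] := greedy_pos n1.
  move: n1m Sm; elim: m => [|m IH].
    by rewrite leqn0 => /eqP n10; move: Sn1; rewrite n10 => /le_gtF ->.
  rewrite leq_eqVlt => /predU1P[n1E|n1m Sm].
    by move: Sn1; rewrite n1E => /le_gtF ->.
  have [Sm0|Sm0] := ltP 0 (S m); first exact: IH.
  exists m.+1; first by lia.
  by have [] := stepP m (leq_trans n01 n1m); lra.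
exists n2 => // n /= n2n; rewrite sub0r normrN.
elim: n n2n => [|n IH]; first by rewrite leqn0 => /eqP <-; rewrite ler_norml; lra.
rewrite leq_eqVlt => /predU1P[<-|n2n]; first by rewrite ler_norml; lra.
have := IH n2n; rewrite !ler_norml => /andP[? ?].
have [|[? ?]|[? ?]] := stepP n; [lia|lra|lra].
Qed.

Lemma greedy_merge : u @ \oo --> 0 -> v @ \oo --> 0 -> exists i j : nat -> nat,
  [/\ i 0%N = 0%N /\ j 0%N = 0%N,
   forall n, (i n.+1 = (i n).+1 /\ j n.+1 = j n) \/
             (i n.+1 = i n /\ j n.+1 = (j n).+1),
   forall K, exists n, (K <= i n)%N /\ (K <= j n)%N &
   (fun n => series u (i n) - series v (j n)) @ \oo --> 0].
Proof.
move=> cu cv; exists i, j; split=> //; last exact: greedy_cvg.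
  by move=> n; case: (greedyS n) => [[_ ?]|[_ ?]]; [left|right].
exact: greedy_unbounded.
Qed.

End Greedy.

(** * Block series *)

Lemma sumr_uniq_sub (R : numDomainType) (I : eqType) (f : I -> R) (r s : seq I) :
  (forall x, 0 <= f x) -> uniq r -> {subset r <= s} ->
  \sum_(x <- r) f x <= \sum_(x <- s) f x.
Proof.
move=> f0; elim: r s => [|x r IH] s /=; first by rewrite big_nil sumr_ge0.
move=> /andP[xr ur] rs; rewrite big_cons (big_rem x (rs _ (mem_head x r))) /= lerD2l.
apply: IH => // y yr.
have ys : y \in s by apply: rs; rewrite inE yr orbT.
have yx : y != x by apply: contraNneq xr => <-.
by have := perm_to_rem (rs _ (mem_head x r)) => /perm_mem/(_ y);
  rewrite ys inE (negbTE yx) => /esym.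
Qed.

Lemma series_uniq_sub (R : realType) (f : nat -> R) (p : nat -> nat) N r :
  (forall n, 0 <= f n) -> uniq r ->
  (forall n, n \in r -> exists2 i, (i < N)%N & p i = n) ->
  \sum_(n <- r) f n <= series (f \o p) N.
Proof.
move=> f0 ur rp; rewrite /series /= -(big_map p xpredT f).
apply: sumr_uniq_sub => // n /rp[i iN <-].
by apply: map_f; rewrite mem_index_iota.
Qed.

Lemma harmonic_unbounded (R : realType) (M : R) :
  exists n, M < series (@harmonic R) n.
Proof.
apply: contrapT => nex; apply: (@dvg_harmonic R).
apply: nondecreasing_is_cvgn.
  move=> m n mn; apply: (@nondecreasing_series _ _ predT) => // k _ _.
  exact: harmonic_ge0.
exists M => _ [n _ <-]; rewrite leNgt; apply/negP => Mn; apply: nex.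
by exists n.
Qed.

Lemma inj_nat_cvg (P : nat -> nat) : injective P ->
  forall N, exists M, forall i, (M <= i)%N -> (N <= P i)%N.
Proof.
move=> PI; elim=> [|N [M MP]]; first by exists 0%N.
have [[i0 Pi0]|nex] := pselect (exists i, P i = N).
  exists (maxn M i0.+1) => i; rewrite geq_max => /andP[/MP Ni i0i].
  rewrite ltn_neqAle Ni andbT -Pi0; apply: contraTneq i0i => /PI ->.
  by rewrite ltnn.
exists M => i /MP; rewrite leq_eqVlt => /predU1P[Ni|//].
by case: nex; exists i.
Qed.

Section BlockSeries.
Variables (R : realType) (blk c : nat -> nat).
Hypothesis blkc : forall k, blk (c k) = k.
Hypothesis blkoo : forall k, exists N, forall n, (N <= n)%N -> (k <= blk n)%N.
Hypothesis belowc : forall k, exists2 n, (n < c k)%N & blk n = k.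

(** The positive terms of a block are twice as large as its negative term, so that
    a single positive term outweighs it. *)
Definition block_series n : R :=
  if n == c (blk n) then - harmonic (blk n) else 2 * harmonic (blk n).

Local Notation a := block_series.
Local Notation h := (@harmonic R).

Let h0 k : 0 < h k. Proof. exact: harmonic_gt0. Qed.
Let h1 k : h k <= 1. Proof. by rewrite /= invf_le1 ?ler1n ?ltr0Sn. Qed.

Lemma block_series_cvg0 : a @ \oo --> 0.
Proof.
apply/cvgrPdist_le => e e0.
have /cvgrPdist_le/(_ (e / 2))[|K _ hK] := @cvg_harmonic R; first lra.
have [N hN] := blkoo K; exists N; [by []|move=> n /= /hN Kn].
have := hK _ Kn; rewrite !sub0r !normrN.
have := h0 (blk n); rewrite /block_series; set x := h _ => x0.
by case: ifP => _; rewrite ?normrN !ger0_norm; lra.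
Qed.

(** A block contributes a negative amount to a rearranged partial sum only as long
    as c k is the only one of its elements to have been met. *)
Lemma block_series_ge (k : nat) p q N : cancel p q -> cancel q p ->
  let T := \sum_(0 <= i < N | blk (p i) == k) a (p i) in
  - h k <= T /\
  forall n, blk n = k -> n != c k -> (q n < q (c k))%N ->
    0 <= T /\ ((q (c k) < N)%N -> h k <= T).
Proof.
move=> pq qp T.
pose ind (m : nat) (x : R) (i : nat) : R := if i == m then x else 0.
have sum_ind m x : \sum_(0 <= i < N) ind m x i = if (m < N)%N then x else 0.
  by rewrite -big_mkcond big_nat1_eq.
have c0 i : blk (p i) = k -> i != q (c k) -> 0 <= a (p i).
  move=> bk iq; rewrite /block_series bk; case: eqVneq => [pc|_].
    by move: iq; rewrite -pc pq eqxx.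
  by have := h0 k; lra.
have TE : T = \sum_(0 <= i < N) (if blk (p i) == k then a (p i) else 0).
  by rewrite /T big_mkcond.
have ac : a (p (q (c k))) = - h k by rewrite qp /block_series blkc eqxx.
split.
  have : - h k <= \sum_(0 <= i < N) ind (q (c k)) (- h k) i.
    by rewrite sum_ind; case: ifP => _ //; have := h0 k; lra.
  move=> /le_trans; apply; rewrite TE; apply: ler_sum => i _.
  rewrite /ind; case: eqVneq => [->|iq]; first by rewrite qp blkc eqxx -ac qp.
  by case: eqVneq => // bk; exact: c0.
move=> n bn nc qn.
have H : (if (q (c k) < N)%N then - h k else 0) +
    (if (q n < N)%N then 2 * h k else 0) <= T.
  rewrite -2!sum_ind -big_split TE; apply: ler_sum => i _ /=.
  rewrite /ind; case: (eqVneq i (q (c k))) => [->|iq].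
    by rewrite qp blkc eqxx -ac qp gtn_eqF // addr0.
  rewrite add0r; case: (eqVneq i (q n)) => [->|_].
    by rewrite qp bn eqxx /block_series bn (negbTE nc).
  by case: eqVneq => // bk; exact: c0.
move: H; have := h0 k.
by case: ltnP => cN; case: ltnP => nN; split=> //; try lra; lia.
Qed.

(** The finitely many blocks below K cost a bounded amount, and every later block
    contributes at least harmonic k as soon as c k has been met. *)
Lemma block_series_perm_pinfty p q : cancel p q -> cancel q p ->
  (exists K, forall k, (K <= k)%N ->
     exists n, [/\ blk n = k, n != c k & (q n < q (c k))%N]) ->
  has_sum (a \o p) +oo%E.
Proof.
move=> pq qp [K good]; apply/cvgeryP/cvgryPge => M.
have [L LM] := harmonic_unbounded (M + 2 *+ K).
exists (\max_(k < L) (q (c k)).+1)%N; [by []|move=> N /= NN].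
have cN k : (k < L)%N -> (q (c k) < N)%N.
  by move=> kL; apply: leq_trans NN; exact: (leq_bigmax (Ordinal kL)).
pose B := maxn (maxn L K) (\max_(i < N) (blk (p i)).+1).
have bB i : (i < N)%N -> (blk (p i) < B)%N.
  move=> iN; apply: leq_trans (leq_maxr _ _).
  exact: (leq_bigmax (Ordinal iN)).
rewrite /series /=.
have -> : \sum_(0 <= i < N) a (p i) =
    \sum_(0 <= k < B) \sum_(0 <= i < N | blk (p i) == k) a (p i).
  rewrite big_mkord.
  rewrite (partition_big (fun i : 'I_N => Ordinal (bB i (ltn_ord i))) predT) //=.
  by rewrite big_mkord; apply: eq_bigr => k _; rewrite big_mkord.
apply: (@le_trans _ _ (\sum_(0 <= k < B) ((if (k < L)%N then h k else 0) -
   (if (k < K)%N then 2 else 0)))).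
  have widen m (F : nat -> R) : (m <= B)%N ->
      \sum_(0 <= k < B) (if (k < m)%N then F k else 0) = \sum_(0 <= k < m) F k.
    by move=> mB; rewrite (big_nat_widen 0 m B) // [RHS]big_mkcond.
  rewrite big_split /= sumrN !widen; [|by rewrite /B; lia..].
  rewrite sumr_const_nat subn0.
  by move: LM; rewrite /series /=; lra.
rewrite !big_nat; apply: ler_sum => k _.
have [T1 T2] := block_series_ge k N pq qp.
have := h0 k; have := h1 k.
case: (ltnP k K) => kK.
  by case: ifP => _; lra.
have [n [bn nc qn]] := good _ kK; have [T3 T4] := T2 n bn nc qn.
by case: ifP => [/cN/T4|_]; lra.
Qed.

Lemma block_series_sum_pinfty : has_sum a +oo%E.
Proof.
apply: (@block_series_perm_pinfty id id) => //; exists 0%N => k _.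
have [n nc bn] := belowc k; exists n; split=> //.
by rewrite ltn_eqF.
Qed.

(** The negative terms are enumerated by c and the others by a bijection P; their
    greedy merge is a convergent rearrangement.  It does not converge absolutely
    because the negative terms alone form the harmonic series. *)
Lemma block_series_pcc : pcc a.
Proof.
pose A := [set n | n != c (blk n)].
have [d dP] := choice (fun k => let: ex_intro2 n h1 h2 := belowc k in
  ex_intro (fun n => (n < c k)%N /\ blk n = k) n (conj h1 h2)).
have Ad k : d k != c (blk (d k)).
  by have [dc bd] := dP k; rewrite bd ltn_eqF.
have cI : injective c by apply: can_inj blkc.
have dI : injective d by apply: (can_inj (g := blk)) => k; case: (dP k).
have [P [PA PI PS]] : exists P, set_bij [set: nat] A P.
  apply/card_set_bijP; rewrite card_eq_sym; apply: eq_card_nat.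
    exact: countableP.
  apply/infiniteP/pcard_leP/injfunPex; exists d => [k _|k l _ _ /dI//].
  exact: Ad.
have {}PI : injective P by move=> x y /PI; apply; rewrite inE.
have {}PA k : P k != c (blk (P k)) by exact: PA.
have {}PS n : n != c (blk n) -> exists k, P k = n.
  by move=> An; have [k _ Pk] := PS n An; exists k.
have aP k : a (P k) = 2 * h (blk (P k)).
  by rewrite /block_series (negbTE (PA k)).
have u0 k : 0 <= a (P k) by rewrite aP; have := h0 (blk (P k)); lra.
have uoo M : exists N, M < series (a \o P) N.
  have [L LM] := harmonic_unbounded M.
  have [e eP] := choice (fun k => PS _ (Ad k)).
  exists (\max_(k < L) (e k).+1)%N; apply: lt_le_trans LM _.
  rewrite -[X in X <= _]addr0.
  have -> : a \o P = (fun n => `|a n|) \o P.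
    by apply/funext => k /=; rewrite ger0_norm.
  apply: le_trans (@series_uniq_sub _ (fun n => `|a n|) P _ (map d (iota 0 L)) _ _ _).
  - rewrite addr0 /series /= big_map /index_iota subn0; apply: ler_sum => k _.
    rewrite /block_series (negbTE (Ad k)) (dP k).2.
    by rewrite ger0_norm; have := h0 k; rewrite /=; move: (_^-1) => x; lra.
  - by move=> n; exact: normr_ge0.
  - by rewrite map_inj_uniq ?iota_uniq.
  - move=> _ /mapP[k + ->]; rewrite mem_iota add0n => /= kL.
    exists (e k) => //; exact: (leq_bigmax (Ordinal kL)).
have cu : (a \o P) @ \oo --> 0.
  have /cvgrPdist_le ca := block_series_cvg0; apply/cvgrPdist_le => e e0.
  have [N _ hN] := ca _ e0; have [M hM] := inj_nat_cvg PI N.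
  by exists M; [by []|move=> i /= /hM/hN].
have [i [j [[i0 j0] ijS ijoo Scvg]]] := greedy_merge u0
  (fun k => ltW (h0 k)) uoo (@harmonic_unbounded R) cu (@cvg_harmonic R).
have mono m n : (m <= n)%N -> (i m <= i n)%N /\ (j m <= j n)%N.
  elim: n => [|n IH]; first by rewrite leqn0 => /eqP ->.
  rewrite leq_eqVlt => /predU1P[->//|/IH].
  by case: (ijS n) => -[-> ->]; lia.
pose p n := if i n.+1 == (i n).+1 then P (i n) else c (j n).
have pI : injective p.
  have lt m n : (m < n)%N -> p m <> p n.
    move=> /mono; rewrite /p; case: eqP => [iS|niS]; case: eqP => [iS'|niS'].
    - by move=> ? /PI; lia.
    - by move=> _ /esym E; have := PA (i m); rewrite -E blkc eqxx.
    - by move=> _ E; have := PA (i n); rewrite -E blkc eqxx.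
    - by case: (ijS m) => -[? ?] // ? /cI; lia.
  by move=> m n E; case: (ltngtP m n) => // /lt; rewrite E.
have pS n : exists m, p m = n.
  have jump (f : nat -> nat) K : f 0%N = 0%N ->
      (forall m, f m.+1 = (f m).+1 \/ f m.+1 = f m) -> (exists m, (K < f m)%N) ->
      exists m, f m = K /\ f m.+1 = K.+1.
    move=> f0 fS [m]; elim: m => [|m IH]; first by rewrite f0.
    by case: (fS m) => E; rewrite E // ltnS leq_eqVlt => /predU1P[->|//]; exists m.
  case: (eqVneq n (c (blk n))) => [nc|/PS[k Pk]].
    have [||m [jm jm1]] := jump j (blk n) j0.
    - by move=> m; case: (ijS m) => -[_ ->]; [right|left].
    - by have [m [_ ?]] := ijoo (blk n).+1; exists m.
    exists m; rewrite /p; case: (ijS m) => -[-> E]; first by lia.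
    by rewrite ltn_eqF // jm -nc.
  have [||m [im im1]] := jump i k i0.
  - by move=> m; case: (ijS m) => -[-> _]; [left|right].
  - by have [m [? _]] := ijoo k.+1; exists m.
  by exists m; rewrite /p im im1 eqxx.
have pE n : series (a \o p) n = series (a \o P) (i n) - series h (j n).
  elim: n => [|n IH]; first by rewrite /series /= i0 j0 !big_geq // subr0.
  rewrite seriesSr IH /= /p; case: (ijS n) => -[-> ->].
    by rewrite eqxx seriesSr addrAC.
  by rewrite ltn_eqF // seriesSr /block_series blkc eqxx opprD addrA.
exists p; first exact: inj_surj_bijective.
split; first by rewrite (funext pE); apply: cvgP Scvg.
move=> /nondecreasing_cvgn_le le.
set l := limn _ in le.
have [L LM] := harmonic_unbounded l.
have [q qP] := choice pS.
have : l < series ((fun n => `|a n|) \o p) (\max_(k < L) (q (c k)).+1)%N.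
  apply: lt_le_trans LM _.
  apply: le_trans (@series_uniq_sub _ (fun n => `|a n|) p _ (map c (iota 0 L)) _ _ _).
  - rewrite /series /= big_map /index_iota subn0; apply: ler_sum => k _.
    by rewrite /block_series blkc eqxx normrN ger0_norm // ltW.
  - by move=> n; exact: normr_ge0.
  - by rewrite map_inj_uniq ?iota_uniq.
  - move=> _ /mapP[k + ->]; rewrite mem_iota add0n => /= kL.
    exists (q (c k)) => //; exact: (leq_bigmax (Ordinal kL)).
apply/negP; rewrite -leNgt; apply: le.
move=> m n mn; apply: (@nondecreasing_series _ _ predT) => // k _ _.
exact: normr_ge0.
Qed.

End BlockSeries.

(** * Families of rearrangements and the first elements of intervals *)

(** Otherwise every rearrangement by an element of Pi has the same sum +oo as the
    block series, contrary to the choice of Pi. *)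
Lemma rr'_family_hits_blocks (R : realType) (Pi : set (nat -> nat))
    (blk c : nat -> nat) :
  rr'_family R Pi -> (forall k, blk (c k) = k) ->
  (forall k, exists N, forall n, (N <= n)%N -> (k <= blk n)%N) ->
  (forall k, exists2 n, (n < c k)%N & blk n = k) ->
  exists2 p, Pi p & forall K, exists k s, [/\ (K <= k)%N, p s = c k &
    forall t, blk (p t) = k -> (s <= t)%N].
Proof.
move=> [PiS Pirr] blkc blkoo belowc.
have [p Pip pa] := Pirr _ _ (@block_series_pcc R _ _ blkc blkoo belowc)
  (@block_series_sum_pinfty R _ _ blkc belowc).
exists p => //; have [q pq qp] := PiS _ Pip.
apply: contrapT => /existsNP[K nK].
have good : has_sum (@block_series R blk c \o p) +oo%E.
  apply: (block_series_perm_pinfty blkc pq qp); exists K => k Kk.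
  apply: contrapT => nex; apply: nK; exists k, (q (c k)); split=> // t bt.
  rewrite leqNgt; apply/negP => tq; apply: nex; exists (p t).
  by rewrite pq; split=> //; apply: contraTneq tq => <-; rewrite pq ltnn.
case: pa => [|[l' l'sum]].
  have [h1 h2] := cvg_limn_einf_sup good.
  by rewrite /diverges_by_oscillation -/(has_sum _ _) h1 h2 ltxx.
by apply; apply: cvg_unique l'sum good.
Qed.

Definition first_in (p : nat -> nat) (lo hi c : nat) :=
  (lo <= c < hi)%N /\
  exists2 s, p s = c & forall t, (lo <= p t < hi)%N -> (s <= t)%N.

Lemma incr_nat_le (v : nat -> nat) : (forall k, (v k < v k.+1)%N) ->
  (forall k l, (k <= l)%N -> (v k <= v l)%N) /\ (forall k, (k <= v k)%N).
Proof.
move=> vS; split.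
  move=> k; elim=> [|l IH]; first by rewrite leqn0 => /eqP ->.
  by rewrite leq_eqVlt => /predU1P[->//|/IH]; have := vS l; lia.
by elim=> // k IH; have := vS k; lia.
Qed.

Lemma rr'_family_hits_intervals (R : realType) (Pi : set (nat -> nat))
    (v c : nat -> nat) :
  rr'_family R Pi -> (forall k, (v k < c k < v k.+1)%N) ->
  exists2 p, Pi p &
    forall K, exists2 k, (K <= k)%N & first_in p (v k) (v k.+1) (c k).
Proof.
move=> Pirr vc.
have vS k : (v k < v k.+1)%N by have := vc k; lia.
have [vmono vge] := incr_nat_le vS.
have ex n : exists k, (n < v k.+1)%N by exists n; apply: leq_trans (vge _).
pose blk n := ex_minn (ex n).
have blkE n k : (v k <= n < v k.+1)%N -> blk n = k.
  move=> /andP[kn nk]; rewrite /blk; case: ex_minnP => m nm mmin.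
  apply/eqP; rewrite eqn_leq mmin //= leqNgt; apply/negP => mk.
  by have := vmono _ _ mk; lia.
have [|||p Pip hit] := @rr'_family_hits_blocks R Pi blk c Pirr.
- by move=> k; apply: blkE; have := vc k; lia.
- move=> k; exists (v k) => n kn; rewrite /blk; case: ex_minnP => m nm _.
  rewrite leqNgt; apply/negP => mk.
  by have := vmono _ _ mk; lia.
- move=> k; exists (v k); first by have := vc k; lia.
  by apply: blkE; rewrite leqnn vS.
exists p => // K; have [k [s [Kk ps smin]]] := hit K; exists k => //.
split; first by have := vc k; lia.
by exists s => // t /blkE; exact: smin.
Qed.

(** The growth rate of j measures how long p postpones small numbers. *)
Definition escapes (p j : nat -> nat) := forall z s t,
  (p s <= j z)%N -> (j z.+1 <= p t)%N -> (s < t)%N.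

Lemma escapes_exists p : bijective p -> exists j, escapes p j.
Proof.
move=> [q pq qp].
have /choice[H HP] : forall m, exists h, forall s t,
    (p s <= m)%N -> (h <= p t)%N -> (s < t)%N.
  move=> m.
  have [h hP] := inj_nat_cvg (can_inj qp) (\max_(i < m.+1) (q i)).+1.
  exists h => s t sm /hP; rewrite pq; apply: leq_trans; rewrite ltnS.
  by rewrite -{1}(pq s); apply: (leq_bigmax (Ordinal (sm : (p s < m.+1)%N))).
exists (fun z => iter z H 0%N) => z s t.
by rewrite iterS; exact: HP.
Qed.

Lemma escapes_incr p j : bijective p -> escapes p j -> forall z, (j z < j z.+1)%N.
Proof.
move=> [q pq qp] jP z; rewrite ltnNge; apply/negP => le.
by have := jP z (q (j z)) (q (j z)); rewrite qp ltnn => /(_ (leqnn _) le).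
Qed.

(** The block series is taken with blocks [v k, v k.+1) where v k.+1 exceeds
    Q (Q (v k)), and with the negative term at the end of each block.  If p lists
    that end before v k, then J p cannot have two values between v k and the
    end.  One of the two gaps of J p around v k is therefore long: two gaps are
    involved, which is why Q is iterated twice. *)
Lemma rr'_family_unbounded (R : realType) (Pi : set (nat -> nat))
    (J : (nat -> nat) -> nat -> nat) (Q : nat -> nat) :
  rr'_family R Pi -> (forall p, Pi p -> escapes p (J p)) ->
  (forall m n, (m <= n)%N -> (Q m <= Q n)%N) -> (forall n, (n < Q n)%N) ->
  exists2 p, Pi p & forall K, exists2 z, (K <= z)%N & (Q (J p z) <= J p z.+1)%N.
Proof.
move=> Pirr JP Qmono Qgt.
pose v k := iter k (fun m => (Q (Q m)).+1) 0%N.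
have vS k : v k.+1 = (Q (Q (v k))).+1 by [].
have vlt k : (v k < Q (Q (v k)))%N.
  by have := Qgt (v k); have := Qgt (Q (v k)); lia.
have [k|p Pip hit] := rr'_family_hits_intervals (c := fun k => Q (Q (v k))) Pirr
  (v := v).
  by rewrite vS vlt /=.
exists p => // K; have jP := JP _ Pip.
have [_ vge] : (forall k l, (k <= l)%N -> (v k <= v l)%N) /\ (forall k, (k <= v k)%N).
  by apply: incr_nat_le => k; rewrite vS; have := vlt k; lia.
have pb : bijective p by exact: Pirr.1.
have [Jmono Jge] := incr_nat_le (escapes_incr pb (JP _ Pip)).
have [k Kk [_ [s ps smin]]] := hit (J p K.+1).+1.
have kv := vge k.
have ex : exists z, (v k <= J p z)%N by exists (v k).
case: (ex_minnP ex) => z vz zmin.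
have Kz : (K.+1 < z)%N.
  by rewrite ltnNge; apply/negP => /Jmono; lia.
have [z' zE] : exists z', z = z'.+1 by exists z.-1; lia.
subst z; have Jz' : (J p z' < v k)%N.
  by rewrite ltnNge; apply/negP => /zmin; rewrite ltnn.
have cJ : (Q (Q (v k)) < J p z'.+2)%N.
  rewrite ltnNge; apply/negP => le.
  have [q pq qp] := pb.
  have := jP z'.+1 (q (v k)) s; rewrite qp ps => /(_ vz le) qs.
  have : (s <= q (v k))%N by apply: smin; rewrite qp leqnn vS ltnS ltnW.
  by rewrite leqNgt qs.
case: (leqP (J p z'.+1) (Q (v k))) => [le|gt].
  by exists z'.+1; [lia|apply: leq_trans (ltnW cJ); exact: Qmono].
by exists z'; [lia|apply: leq_trans (ltnW gt); apply: Qmono; lia].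
Qed.

Definition bit (n m : nat) : bool := odd (n %/ 2 ^ m).

Fixpoint of_bits (s : nat -> bool) L : nat :=
  if L is L'.+1 then (of_bits s L' + s L' * 2 ^ L')%N else 0%N.

Lemma of_bits_lt s L : (of_bits s L < 2 ^ L)%N.
Proof.
elim: L => //= L IH; rewrite expnS mul2n -addnn.
by case: (s L); rewrite ?mul1n ?mul0n; lia.
Qed.

Lemma bit_of_bits s L m : (m < L)%N -> bit (of_bits s L) m = s m.
Proof.
rewrite /bit; elim: L => // L IH; rewrite ltnS leq_eqVlt => /predU1P[->|mL] /=.
  rewrite divnDMl ?expn_gt0 // divn_small ?of_bits_lt // add0n.
  by case: (s L).
rewrite (_ : 2 ^ L = 2 ^ (L - m) * 2 ^ m)%N; last by rewrite -expnD subnK // ltnW.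
rewrite mulnA divnDMl ?expn_gt0 // oddD oddM oddX subn_eq0 leqNgt mL.
by rewrite andbF addbF IH.
Qed.

(** This places the code of a word whose top bit is set in the right dyadic
    interval. *)
Lemma bit_ge n m : bit n m -> (2 ^ m <= n)%N.
Proof.
by rewrite /bit; apply: contraTT; rewrite -ltnNge => lt; rewrite divn_small.
Qed.

Lemma first_in_uniq p lo hi c c' :
  first_in p lo hi c -> first_in p lo hi c' -> c = c'.
Proof.
move=> [lc [s ps smin]] [lc' [t pt tmin]].
have /smin st : (lo <= p t < hi)%N by rewrite pt.
have /tmin ts : (lo <= p s < hi)%N by rewrite ps.
by rewrite -ps -pt; congr p; lia.
Qed.

(** The words predicted on the disjoint intervals [j z, j z.+1) glue together
    because a first element is unique. *)
Lemma prediction_exists (p j : nat -> nat) : (forall z, (j z < j z.+1)%N) ->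
  exists x : nat -> bool, forall z c m,
    first_in p (2 ^ j z) (2 ^ j z.+1) c -> (j z <= m < j z.+1)%N -> x m = bit c m.
Proof.
move=> jS; have [jmono _] := incr_nat_le jS.
suff /choice[x xP] : forall m, exists b : bool, forall z c,
    first_in p (2 ^ j z) (2 ^ j z.+1) c -> (j z <= m < j z.+1)%N -> b = bit c m.
  by exists x => z c m; exact: xP.
move=> m; have [[z [c [cP zm]]]|nex] := pselect (exists z c,
    first_in p (2 ^ j z) (2 ^ j z.+1) c /\ (j z <= m < j z.+1)%N); last first.
  by exists false => z c cP zm; case: nex; exists z, c.
exists (bit c m) => z' c' c'P z'm.
have zz' : z = z'.
  case: (ltngtP z z') => // /jmono; lia.
by rewrite -zz' in c'P; rewrite (first_in_uniq cP c'P).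
Qed.

Section Matching.
Variables (R : realType) (Pi : set (nat -> nat)).
Hypothesis Pirr : rr'_family R Pi.
Variables (J : (nat -> nat) -> nat -> nat).
Hypothesis JP : forall p, Pi p -> escapes p (J p).
Variable x : (nat -> nat) -> (nat -> nat) -> nat -> bool.
Hypothesis xP : forall p r, Pi p -> Pi r -> forall z c m,
  first_in p (2 ^ J r z) (2 ^ J r z.+1) c -> (J r z <= m < J r z.+1)%N ->
  x p r m = bit c m.

(** The blocks are bounded by 2 ^ J r (e k), where e runs through places at which
    J r makes a long jump.  The first element of a block is then also the first
    element of the shorter interval that ends at 2 ^ J r (e k).+1, whose elements
    code the words on [J r (e k), J r (e k).+1). *)
Lemma rr'_family_matches (Q : nat -> nat) (s : nat -> nat -> bool) :
  (forall n, (n < Q n)%N) ->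
  exists p r, [/\ Pi p, Pi r & forall K, exists2 n, (K <= n)%N &
    forall m, (n <= m < Q n)%N -> x p r m = s n m].
Proof.
move=> Qgt.
pose Q' n := (\max_(i < n.+1) Q i).+1.
have QQ' n : (Q n < Q' n)%N by rewrite ltnS; exact: (leq_bigmax (@ord_max n)).
have Q'mono m n : (m <= n)%N -> (Q' m <= Q' n)%N.
  move=> mn; rewrite ltnS; apply/bigmax_leqP => i _.
  have in1 : (i < n.+1)%N by apply: leq_trans (ltn_ord i) _; rewrite ltnS.
  exact: (leq_bigmax (Ordinal in1)).
have [n|r Pr fast] := rr'_family_unbounded Pirr JP Q'mono.
  by have := QQ' n; have := Qgt n; lia.
have [f fP] := choice (fun K => let: ex_intro2 z h1 h2 := fast K in
  ex_intro (fun z => (K <= z)%N /\ (Q' (J r z) <= J r z.+1)%N) z (conj h1 h2)).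
have jS := escapes_incr (Pirr.1 _ Pr) (JP Pr).
have [jmono jge] := incr_nat_le jS.
pose e := fix e k := if k is k'.+1 then f (e k').+1 else f 0%N.
have eS k : (e k < e k.+1)%N by case: (fP (e k).+1).
have eQ k : (Q' (J r (e k)) <= J r (e k).+1)%N.
  by case: k => [|k] /=; [case: (fP 0%N)|case: (fP (e k).+1)].
have [_ ege] := incr_nat_le eS.
pose b k m := (m == (J r (e k).+1).-1) || s (J r (e k)) m.
pose c k := of_bits (b k) (J r (e k).+1).
have vc k : (2 ^ J r (e k) < c k < 2 ^ J r (e k.+1))%N.
  have := eQ k; have := QQ' (J r (e k)); have := Qgt (J r (e k)) => q1 q2 q3.
  apply/andP; split.
    apply: (@leq_trans (2 ^ (J r (e k).+1).-1)%N); first by rewrite ltn_exp2l //; lia.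
    by apply: bit_ge; rewrite bit_of_bits; [rewrite /b eqxx|lia].
  apply: leq_trans (of_bits_lt _ _) _; rewrite leq_exp2l //.
  exact: jmono.
have [p Pp hit] := rr'_family_hits_intervals Pirr vc.
exists p, r; split=> // K; have [k Kk [ck [t pt tmin]]] := hit K.
have ckJ : (c k < 2 ^ J r (e k).+1)%N by exact: of_bits_lt.
have fi : first_in p (2 ^ J r (e k)) (2 ^ J r (e k).+1) (c k).
  split; first by move: ck => /andP[-> _].
  exists t => // u /andP[u1 u2]; apply: tmin; rewrite u1 /=.
  by apply: leq_trans u2 _; rewrite leq_exp2l //; exact: jmono.
exists (J r (e k)); first by have := jge (e k); have := ege k; lia.
move=> m /andP[m1 m2]; have := eQ k; have := QQ' (J r (e k)) => q1 q2.
rewrite (xP Pp Pr fi); last by lia.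
rewrite bit_of_bits; last by lia.
by rewrite /b; case: eqP => //; lia.
Qed.

End Matching.

(** * Nowhere dense sets in binary *)

(** The first bit is the most significant one, so that this is the numerator of a
    dyadic approximation of [binary x]. *)
Fixpoint prefix_code (x : nat -> bool) n : nat :=
  if n is n'.+1 then (2 * prefix_code x n' + x n')%N else 0%N.

Lemma prefix_code_lt x n : (prefix_code x n < 2 ^ n)%N.
Proof. by elim: n => //= n IH; rewrite expnS; case: (x n); lia. Qed.

Lemma prefix_codeP x y n :
  prefix_code x n = prefix_code y n <-> forall m, (m < n)%N -> x m = y m.
Proof.
elim: n => [|n IH] /=; first by split.
split=> [E|xy].
  have xyn : x n = y n by case: (x n) (y n) E => [] [] /=; lia.
  have /IH xy : prefix_code x n = prefix_code y n by move: E; rewrite xyn; lia.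
  by move=> m; rewrite ltnS leq_eqVlt => /predU1P[->|/xy].
by rewrite xy // (IH.2 _) // => m mn; apply: xy; lia.
Qed.

Lemma prefix_code_extend x n k j : (j %/ 2 ^ k)%N = prefix_code x n ->
  exists y, (forall m, (m < n)%N -> y m = x m) /\ prefix_code y (n + k)%N = j.
Proof.
elim: k j => [|k IH] j; first by rewrite expn0 divn1 => ->; exists x; rewrite addn0.
rewrite expnS divnMA => /IH[y [yx yj]].
exists (fun m => if m == (n + k)%N then odd j else y m); split.
  by move=> m mn; rewrite ltn_eqF ?yx //; lia.
rewrite addnS /= eqxx.
have -> : prefix_code (fun m => if m == (n + k)%N then odd j else y m) (n + k) =
    prefix_code y (n + k).
  by apply/prefix_codeP => m mnk; rewrite ltn_eqF.
by rewrite yj mul2n divn2 addnC odd_double_half.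
Qed.

Lemma prefix_code_mono x n k :
  (prefix_code x n * 2 ^ k <= prefix_code x (n + k))%N /\
  (prefix_code x (n + k) < (prefix_code x n).+1 * 2 ^ k)%N.
Proof.
elim: k => [|k [IH1 IH2]]; first by rewrite addn0 expn0 !muln1.
by rewrite addnS expnS /=; case: (x (n + k)%N); split; nia.
Qed.

Section Binary.
Variable R : realType.

(** The real number 0.x_0 x_1 x_2 ... in base 2. *)
Definition binary (x : nat -> bool) : R :=
  sup (range (fun n => (prefix_code x n)%:R / 2 ^+ n)).

Lemma binary_bounds x n :
  (prefix_code x n)%:R <= binary x * 2 ^+ n <= (prefix_code x n).+1%:R.
Proof.
have p2 m : 0 < 2 ^+ m :> R by rewrite exprn_gt0.
have ub m : (prefix_code x m)%:R / 2 ^+ m <= (prefix_code x n).+1%:R / 2 ^+ n :> R.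
  rewrite ler_pdivrMr // mulrAC ler_pdivlMr // -!natrX -!natrM ler_nat.
  have [nm|/ltnW mn] := leqP n m.
    have [_] := prefix_code_mono x n (m - n); rewrite subnKC // => h.
    have -> : (2 ^ m = 2 ^ n * 2 ^ (m - n))%N by rewrite -expnD subnKC.
    by move: h; move: (2 ^ (m - n))%N (2 ^ n)%N => u v; nia.
  have [h _] := prefix_code_mono x m (n - m); move: h; rewrite subnKC // => h.
  have -> : (2 ^ n = 2 ^ m * 2 ^ (n - m))%N by rewrite -expnD subnKC.
  by move: h; move: (2 ^ (n - m))%N (2 ^ m)%N => u v; nia.
rewrite -ler_pdivrMr // -[X in _ && X]ler_pdivlMr //; apply/andP; split.
  apply: ub_le_sup; last by exists n.
  by exists ((prefix_code x n).+1%:R / 2 ^+ n) => _ [m _ <-].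
apply: ge_sup; first by exists (0%:R / 2 ^+ 0), 0%N.
by move=> _ [m _ <-].
Qed.

Lemma pow2_gt (e : R) : 0 < e -> exists n0, forall n, (n0 <= n)%N -> 1 < e * 2 ^+ n.
Proof.
move=> e0; exists (Num.bound e^-1) => n n0n.
rewrite mulrC -ltr_pdivrMr // div1r.
apply: lt_le_trans (archi_boundP _) _; first by rewrite invr_ge0 ltW.
by rewrite -natrX ler_nat; apply: leq_trans n0n (ltnW (ltn_expl _ _)).
Qed.

Lemma nowhere_denseP (F : set R) (lo hi : R) : nowhere_dense F -> lo < hi ->
  exists z, lo < z < hi /\
    exists2 e : R, 0 < e & forall y, `|z - y| < e -> ~ F y.
Proof.
move=> nd lohi.
have : ~ (`]lo, hi[ `<=` closure F).
  move=> /interiorS; rewrite nd => sub.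
  have : `]lo, hi[%classic ((lo + hi) / 2).
    by rewrite /= in_itv /=; apply/andP; split; lra.
  by move: sub; rewrite (interior_id _).1; [move=> sub /sub|exact: interval_open].
move=> /existsNP[z /not_implyP[]]; rewrite /= in_itv /= => zin zF.
exists z; split=> //.
have : nbhs z (~` closure F).
  by apply: open_nbhs_nbhs; split=> //; rewrite openC; exact: closed_closure.
rewrite -nbhs_ballE => -[e /= e0 eF]; exists e => // y zy Fy.
by apply: (eF y) => //; exact: subset_closure.
Qed.

(** The dyadic interval of the prefix contains a ball that misses F, and a small
    enough dyadic interval around the centre of the ball is inside the ball. *)
Lemma avoid_above_prefix (F : set R) x n : nowhere_dense F ->
  exists k y, (forall m, (m < n)%N -> y m = x m) /\
    forall w, prefix_code w (n + k) = prefix_code y (n + k) -> ~ F (binary w).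
Proof.
move=> nd; have p2 m : 0 < 2 ^+ m :> R by rewrite exprn_gt0.
have [|z [/andP[z1 z2] [e e0 eF]]] := @nowhere_denseP F
  ((prefix_code x n)%:R / 2 ^+ n) ((prefix_code x n).+1%:R / 2 ^+ n) nd.
  by rewrite ltr_pM2r ?invr_gt0 // ltr_nat.
have [n0 hn0] := pow2_gt e0.
have z0 : 0 <= z by apply: le_trans (ltW z1); rewrite divr_ge0 // ltW.
have zp m : 0 <= z * 2 ^+ m by rewrite mulr_ge0 // ltW.
pose j := Num.truncn (z * 2 ^+ (n + n0)).
have /andP[j1 j2] : j%:R <= z * 2 ^+ (n + n0) < j.+1%:R by exact: truncn_itv.
have jx : (j %/ 2 ^ n0)%N = prefix_code x n.
  move: z1 z2; rewrite ltr_pdivrMr // ltr_pdivlMr // => z1 z2.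
  have a1 : (prefix_code x n * 2 ^ n0 < j.+1)%N.
    rewrite -(ltr_nat R); apply: le_lt_trans j2.
    by rewrite natrM natrX exprD mulrA ler_pM2r // ltW.
  have a2 : (j < (prefix_code x n).+1 * 2 ^ n0)%N.
    rewrite -(ltr_nat R); apply: le_lt_trans j1 _.
    by rewrite natrM natrX exprD mulrA ltr_pM2r.
  apply/eqP; rewrite eqn_leq leq_divRL ?expn_gt0 // -ltnS ltn_divLR ?expn_gt0 //.
  by rewrite a2 -ltnS.
have [y [yx yj]] := prefix_code_extend jx.
exists n0, y; split=> // w; rewrite yj => wj; apply: eF.
have /andP[w1 w2] := binary_bounds w (n + n0).
move: w1 w2; rewrite wj => w1 w2.
rewrite -(ltr_pM2r (p2 (n + n0)%N)) -[X in _ * X](gtr0_norm (p2 (n + n0)%N)).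
rewrite -normrM mulrBl; apply: le_lt_trans (hn0 _ (leq_addl _ _)).
move: j2 w2; rewrite -[j.+1%:R]natr1 ler_norml; lra.
Qed.

(** The word s must work after all the prefixes of length p at once.  There are
    finitely many, so they are treated one after the other, each time lengthening
    the word obtained so far; M counts the prefixes already treated. *)
Lemma avoid_prefixes (F : set R) p M : nowhere_dense F ->
  exists q s, (p <= q)%N /\ forall x, (prefix_code x p < M)%N ->
    (forall m, (p <= m < q)%N -> x m = s m) -> ~ F (binary x).
Proof.
move=> nd; elim: M => [|M [q' [s' [pq' IH]]]].
  by exists p, (fun=> false); split.
have [[x0 x0M]|nex] := pselect (exists x, prefix_code x p = M); last first.
  exists q', s'; split=> // x; rewrite ltnS leq_eqVlt => /predU1P[xM|]; last exact: IH.
  by case: nex; exists x.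
pose x1 m := if (m < p)%N then x0 m else s' m.
have [k [y [yx1 yF]]] := avoid_above_prefix x1 q' nd.
exists (q' + k)%N, y; split; first by lia.
move=> x; rewrite ltnS leq_eqVlt => /predU1P[xM|xM] xy.
  apply: yF; apply/prefix_codeP => m mq.
  have [mp|pm] := ltnP m p; last by apply: xy; lia.
  rewrite yx1 /x1 ?mp; last by lia.
  by move: m mp {mq}; apply/prefix_codeP; rewrite x0M.
apply: IH => // m mq; rewrite xy; last by lia.
rewrite yx1; last by lia.
by rewrite /x1 ltnNge; case: leqP => //; lia.
Qed.

Lemma avoid_block (F : nat -> set R) p r : (forall i, nowhere_dense (F i)) ->
  exists q s, (p <= q)%N /\ forall x,
    (forall m, (p <= m < q)%N -> x m = s m) ->
    forall i, (i < r)%N -> ~ F i (binary x).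
Proof.
move=> nd; elim: r => [|r [q' [s' [pq' IH]]]].
  by exists p, (fun=> false); split.
have [q [s [q'q sF]]] := avoid_prefixes q' (2 ^ q') (nd r).
exists q, (fun m => if (m < q')%N then s' m else s m); split; first by lia.
move=> x xs i; rewrite ltnS leq_eqVlt => /predU1P[->|].
  apply: sF; first exact: prefix_code_lt.
  by move=> m /andP[m1 m2]; rewrite xs ?(leq_trans pq' m1) // ltnNge m1.
by apply: IH => m /andP[m1 m2]; rewrite xs ?m2 // m1; lia.
Qed.

(** The combinatorial form of meagerness: matching [s n] on the block [n, Q n) for
    infinitely many n is enough to escape all the F i. *)
Lemma nowhere_dense_blocks (F : nat -> set R) : (forall i, nowhere_dense (F i)) ->
  exists Q s, forall n, (n < Q n)%N /\ forall x,
    (forall m, (n <= m < Q n)%N -> x m = s n m) ->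
    forall i, (i <= n)%N -> ~ F i (binary x).
Proof.
move=> nd; have /choice[Q /choice[s QsP]] : forall n, exists q s,
    (n < q)%N /\ forall x,
    (forall m, (n <= m < q)%N -> x m = s m) ->
    forall i, (i <= n)%N -> ~ F i (binary x).
  move=> n; have [q [s [nq sF]]] := avoid_block n n.+1 nd.
  exists q.+1, s; split=> // x xs i; rewrite -ltnS; apply: sF => m mq.
  by apply: xs; lia.
by exists Q, s.
Qed.

End Binary.

(** * From a family of rearrangements to a nonmeager set *)

Lemma sub_singleton_nowhere_dense (R : realType) (x : R) (A : set R) :
  A `<=` [set x] -> nowhere_dense A.
Proof.
move=> Ax; rewrite /nowhere_dense -subset0 => y.
have cl : closure A `<=` [set x].
  by rewrite closureE => z; apply; split=> //; exact: closed1.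
rewrite /interior -nbhs_ballE => -[e /= e0 eA].
have yx : y = x by apply/cl/eA; exact: ballxx.
have : y + e / 2 = x.
  by apply/cl/eA; rewrite /ball /= opprD addrA subrr sub0r normrN ger0_norm; lra.
by rewrite yx; lra.
Qed.

Lemma countable_meager (R : realType) (X : set R) : countable X -> meager X.
Proof.
move=> /countable_injP[f fI]; exists (fun n => [set x | X x /\ f x = n]).
split=> [n|x Xx]; last by exists (f x).
have [[x [Xx fx]]|nex] := pselect (exists x, X x /\ f x = n).
  apply: (@sub_singleton_nowhere_dense _ x) => y [Xy fy].
  by apply: fI; rewrite ?inE // fx.
apply: (@sub_singleton_nowhere_dense _ 0) => y Xy.
by case: nex; exists y.
Qed.

(** Pi is infinite because otherwise the finitely many reals defined by its pairs
    would form a meager set. *)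
Lemma rr'_family_to_nonmeager (R : realType) (Pi : set (nat -> nat)) :
  rr'_family R Pi -> exists2 X : set R, nonmeager X & X #<= Pi.
Proof.
move=> Pirr.
have /choice[J JP] : forall p, exists j, Pi p -> escapes p j.
  move=> p; have [Pp|nPp] := pselect (Pi p); last by exists id => /nPp.
  by have [j jP] := escapes_exists (Pirr.1 _ Pp); exists j.
have /choice[x xP] : forall pr : (nat -> nat) * (nat -> nat),
    exists x : nat -> bool, Pi pr.2 -> forall z c m,
      first_in pr.1 (2 ^ J pr.2 z) (2 ^ J pr.2 z.+1) c ->
      (J pr.2 z <= m < J pr.2 z.+1)%N -> x m = bit c m.
  move=> [p r]; have [Pr|nPr] := pselect (Pi r); last by exists xpredT => /nPr.
  have [x xP] := prediction_exists p (escapes_incr (Pirr.1 _ Pr) (JP _ Pr)).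
  by exists x.
pose X := (fun pr => @binary R (x pr)) @` (Pi `*` Pi).
have Xnm : nonmeager X.
  move=> [F [Fnd XF]].
  have [Q [s QsP]] := nowhere_dense_blocks Fnd.
  have [||p [r [Pp Pr match_]]] := @rr'_family_matches R Pi Pirr J JP
      (fun p r => x (p, r)) _ Q s.
  - by move=> p r _ Pr z c m; apply: (xP (p, r)).
  - by move=> n; case: (QsP n).
  have [n _ Fn] := XF _ (imageP _ (conj Pp Pr : (Pi `*` Pi) (p, r))).
  have [m nm /((QsP m).2 _)] := match_ n.
  by move=> /(_ _ nm).
exists X => //; apply: card_le_trans (card_image_le _ _) _.
apply: card_setX_le => Pifin; apply: Xnm; apply: countable_meager.
by apply: finite_set_countable; apply/finite_image/finite_setX.
Qed.

(** * From a nonmeager set to a family of rearrangements *)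

Section Digits.
Variable R : realType.
Implicit Types (y z : R).

(** The binary digits of the fractional part of y, from the floor of y * 2 ^ k
    rather than from an expansion, so that they make sense for every real. *)
Definition digits y K : seq bool :=
  mkseq (fun k => odd `|Num.floor (y * 2 ^+ k.+1)|%N) K.

Lemma digitsS y K :
  digits y K.+1 = rcons (digits y K) (odd `|Num.floor (y * 2 ^+ K.+1)|%N).
Proof. by rewrite /digits mkseqS. Qed.

Lemma floor_half y K (j : int) (b : bool) :
  Num.floor (y * 2 ^+ K.+1) = 2 * j + b%:Z -> Num.floor (y * 2 ^+ K) = j.
Proof.
move=> E; have := floor_itv (y * 2 ^+ K.+1); rewrite E => /andP[].
rewrite exprS mulrCA => h1 h2; apply: floor_def; move: h1 h2.
rewrite !intrD !intrM; case: b {E} => /=; lra.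
Qed.

Lemma floor_digits_eq y z K :
  Num.floor (y * 2 ^+ K) = Num.floor (z * 2 ^+ K) -> digits y K = digits z K.
Proof.
elim: K => // K IH E; rewrite !digitsS E IH //.
pose m := Num.floor (z * 2 ^+ K.+1).
have [j [b jb]] : exists j (b : bool), m = 2 * j + b%:Z.
  exists (m %/ 2)%Z, ((m %% 2)%Z == 1); lia.
by rewrite (@floor_half z K j b) // (@floor_half y K j b) // E.
Qed.

Lemma digits_extend K (j : int) (s : seq bool) : exists j' : int,
  forall y, Num.floor (y * 2 ^+ (K + size s)) = j' ->
    Num.floor (y * 2 ^+ K) = j /\ digits y (K + size s) = digits y K ++ s.
Proof.
elim: s K j => [|b s IH] K j.
  by exists j => y; rewrite addn0 cats0.
have [j' j'P] := IH K.+1 (2 * j + b%:Z).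
exists j' => y /=; rewrite addnS -addSn => /j'P[E ->].
split; first exact: floor_half E.
rewrite digitsS E cat_rcons; congr (_ ++ _ :: _).
by case: b {j'P E} => /=; lia.
Qed.

(** Every ball contains a dyadic interval, and a continuation of its digits that
    lies in D cuts out a smaller interval that misses the set. *)
Lemma avoid_dense_nowhere_dense (D : set (seq bool)) :
  (forall s, exists t, D (s ++ t)) ->
  nowhere_dense [set y | forall K, ~ D (digits y K)].
Proof.
move=> dense; rewrite /nowhere_dense -subset0 => z.
have p2 m : 0 < 2 ^+ m :> R by rewrite exprn_gt0.
rewrite /interior -nbhs_ballE => -[e /= e0 eN].
have [K0 hK] := pow2_gt e0; pose K := K0.
have [t Dt] := dense (digits z K).
have [j jP] := digits_extend K (Num.floor (z * 2 ^+ K)) t.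
pose K' := (K + size t)%N.
have jball y : `|y * 2 ^+ K' - (j%:~R + 2^-1)| < 2^-1 ->
    Num.floor (y * 2 ^+ K') = j.
  by rewrite ltr_norml => yj; apply: floor_def; rewrite intrD; lra.
pose w : R := (j%:~R + 2^-1) / 2 ^+ K'.
have wE : w * 2 ^+ K' = j%:~R + 2^-1 by rewrite mulfVK // gt_eqF.
have [wz _] : Num.floor (w * 2 ^+ K) = Num.floor (z * 2 ^+ K) /\
    digits w K' = digits w K ++ t.
  apply: jP; apply: jball; rewrite -/K' wE subrr normr0 invr_gt0; lra.
have : closure [set y | forall K, ~ D (digits y K)] w.
  apply: eN; rewrite /ball /= -(ltr_pM2r (p2 K)) -[X in _ * X](gtr0_norm (p2 K)).
  rewrite -normrM mulrBl; apply: le_lt_trans (hK K (leqnn _)).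
  have := floor_itv (w * 2 ^+ K).
  have := floor_itv (z * 2 ^+ K).
  by rewrite wz intrD ler_norml; lra.
have e1 : 0 < 2^-1 / 2 ^+ K' :> R by rewrite divr_gt0 // invr_gt0.
move=> /(_ _ (nbhsx_ballx w _ e1))[y [yN]].
rewrite /ball /= ltr_pdivlMr // -[X in _ * X](gtr0_norm (p2 K')) -normrM mulrBl.
rewrite wE distrC => /jball/jP[yz yt]; apply: (yN K').
by rewrite yt (floor_digits_eq yz).
Qed.

End Digits.

(** Bits are instructions: [false] counts and [true] lists the count.  Any finite
    list of new numbers can be spelled in this way, and a finite word never
    restricts what can be listed after it. *)
Definition read (st : seq nat * nat) (b : bool) : seq nat * nat :=
  if b then (if st.2 \in st.1 then st.1 else rcons st.1 st.2, 0%N)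
  else (st.1, st.2.+1).

Definition run (s : seq bool) := foldl read ([::], 0%N) s.
Definition word s := (run s).1.

Lemma run_cat s t : run (s ++ t) = foldl read (run s) t.
Proof. by rewrite /run foldl_cat. Qed.

Lemma word_uniq s : uniq (word s).
Proof.
elim/last_ind: s => // s b; rewrite /word -cats1 run_cat /=.
case: (run s) => w c /=; rewrite /read; case: b => //=.
by case: ifPn => // cw; rewrite rcons_uniq cw.
Qed.

Lemma word_cat s t : exists u, word (s ++ t) = word s ++ u.
Proof.
elim/last_ind: t => [|t b [u]]; first by exists [::]; rewrite !cats0.
rewrite -cats1 catA /word (run_cat _ [:: b]) /=.
case: (run (s ++ t)) => w c /= ->; rewrite /read; case: b => /=; last by exists u.
case: ifPn => _; first by exists u.
by exists (rcons u c); rewrite rcons_cat.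
Qed.

Lemma word_extend s u : (run s).2 = 0%N -> uniq (word s ++ u) ->
  exists t, word (s ++ t) = word s ++ u.
Proof.
elim: u s => [|n u IH] s s0 uu; first by exists [::]; rewrite !cats0.
have cnt k : run (s ++ nseq k false) = (word s, k).
  rewrite run_cat; have -> : run s = (word s, 0%N) by rewrite -s0 -surjective_pairing.
  suff H i : foldl read (word s, i) (nseq k false) = (word s, (i + k)%N) by rewrite H.
  by elim: k i => [|k IHk] i /=; rewrite ?addn0 // IHk /= addnS.
have nw : n \notin word s.
  by move: uu; rewrite cat_uniq /= negb_or -andbA => /and3P[].
have E : run (s ++ rcons (nseq n false) true) = (rcons (word s) n, 0%N).
  by rewrite -cats1 catA run_cat cnt /= /read /= (negbTE nw).
have [||t tE] := IH (s ++ rcons (nseq n false) true).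
- by rewrite E.
- by rewrite /word E /= cat_rcons.
by exists (rcons (nseq n false) true ++ t); rewrite catA tE /word E /= cat_rcons.
Qed.

(** One [true] resets the counter, at the price of listing at most one number that
    was not chosen; from then on any new numbers can be listed. *)
Lemma word_free_extend s : exists2 w, uniq w &
  forall u, uniq (w ++ u) -> exists t, word (s ++ t) = w ++ u.
Proof.
exists (word (s ++ [:: true])); first exact: word_uniq.
move=> u /word_extend[|t]; first by rewrite run_cat /= /read /=.
by rewrite -catA => tE; exists ([:: true] ++ t).
Qed.

Lemma chain_bijection (L : nat -> seq nat) :
  (forall K, uniq (L K)) -> (forall K, exists u, L K.+1 = L K ++ u) ->
  (forall m, exists K, m \in L K) ->
  exists2 p : nat -> nat, bijective p &
    forall K i, (i < size (L K))%N -> p i = nth 0%N (L K) i.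
Proof.
move=> Lu LS Lc.
have Lle K K' : (K <= K')%N -> exists u, L K' = L K ++ u.
  elim: K' => [|K' IH]; first by rewrite leqn0 => /eqP ->; exists [::]; rewrite cats0.
  rewrite leq_eqVlt => /predU1P[->|/IH[u uE]]; first by exists [::]; rewrite cats0.
  by have [v ->] := LS K'; exists (u ++ v); rewrite uE catA.
have Lnth K K' i : (i < size (L K))%N -> (i < size (L K'))%N ->
    nth 0%N (L K) i = nth 0%N (L K') i.
  move=> iK iK'; case/orP: (leq_total K K') => /Lle[u ->].
    by rewrite nth_cat iK.
  by rewrite nth_cat iK'.
have Lmem m : exists K, forall n, (n < m)%N -> n \in L K.
  elim: m => [|m [K KP]]; first by exists 0%N.
  have [K' mK'] := Lc m; exists (maxn K K') => n; rewrite ltnS leq_eqVlt.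
  have [u uE] := Lle _ _ (leq_maxl K K'); have [v vE] := Lle _ _ (leq_maxr K K').
  by move=> /predU1P[->|/KP nK]; [rewrite vE|rewrite uE]; rewrite mem_cat ?mK' ?nK.
have /choice[k kP] : forall i, exists K, (i < size (L K))%N.
  move=> i; have [K KP] := Lmem i.+1; exists K.
  rewrite -[X in (X < _)%N]/i -[i.+1](size_iota 0).
  apply: uniq_leq_size; first exact: iota_uniq.
  by move=> n; rewrite mem_iota => /andP[_]; exact: KP.
pose p i := nth 0%N (L (k i)) i.
have pE K i : (i < size (L K))%N -> p i = nth 0%N (L K) i.
  by move=> iK; apply: Lnth.
exists p => //; apply: inj_surj_bijective => [i i' E|m].
  pose K := maxn (k i) (k i').
  have iK : (i < size (L K))%N.
    by have [u ->] := Lle _ _ (leq_maxl (k i) (k i')); rewrite size_cat ltn_addr.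
  have iK' : (i' < size (L K))%N.
    by have [u ->] := Lle _ _ (leq_maxr (k i) (k i')); rewrite size_cat ltn_addr.
  by apply/eqP; rewrite -(nth_uniq 0%N iK iK' (Lu K)) -!pE // E.
have [K mK] := Lc m; exists (index m (L K)).
by rewrite (pE K) ?index_mem // nth_index.
Qed.

Section Oscillation.
Variable R : realType.
Implicit Types (a : nat -> R).

Lemma pccN a : pcc a -> pcc (fun n => - a n).
Proof.
move=> [p Sp [cv ncv]]; exists p => //; split.
  have -> : series ((fun n => - a n) \o p) = - series (a \o p).
    by apply/funext => n; rewrite /series /= sumrN.
  exact: is_cvgN.
move: ncv; apply: contra_not.
rewrite (_ : [normed series _] = [normed series (a \o p)]) //.
by apply/funext => n; rewrite /series /=; apply: eq_bigr => i _; rewrite normrN.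
Qed.

(** Otherwise the positive parts have bounded partial sums along the convergent
    rearrangement, hence converge; as |x| = 2 x^+ - x, the convergence would be
    absolute. *)
Lemma pcc_large_sum a (w : seq nat) M : pcc a -> uniq w ->
  exists2 u, uniq (w ++ u) & M < \sum_(n <- u) a n.
Proof.
move=> [p [q pq qp] [cv ncv]] uw; apply: contrapT => nex; apply: ncv.
pose b n := Num.max (a n) 0.
have b0 n : 0 <= b n by rewrite le_max lexx orbT.
have bound N : series (b \o p) N <= \sum_(n <- w) b n + M.
  pose r := [seq p i | i <- index_iota 0 N].
  have ur : uniq r by rewrite map_inj_uniq ?iota_uniq //; exact: can_inj pq.
  have -> : series (b \o p) N = \sum_(n <- r) b n by rewrite big_map.
  rewrite (bigID (fun n => n \in w)) /=; apply: lerD; last first.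
    rewrite leNgt; apply/negP => Mlt; apply: nex.
    exists [seq n <- r | (n \notin w) && (0 <= a n)].
      rewrite cat_uniq uw filter_uniq // andbT; apply/hasPn => n.
      by rewrite mem_filter -andbA => /andP[].
    rewrite big_filter; apply: lt_le_trans Mlt _.
    rewrite big_mkcondr; apply: ler_sum => n _.
    by rewrite /b; case: (leP 0 (a n)).
  rewrite -big_filter; apply: sumr_uniq_sub => //; first exact: filter_uniq.
  by move=> n; rewrite mem_filter => /andP[].
have cvb : cvgn (series (b \o p)).
  apply: nondecreasing_is_cvgn.
    by move=> m n mn; apply: (@nondecreasing_series _ _ predT) => // k _ _; exact: b0.
  by exists (\sum_(n <- w) b n + M) => _ [n _ <-].
rewrite (_ : [normed series _] =
  (series (b \o p) + series (b \o p)) - series (a \o p)); last first.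
  apply/funext => n; rewrite /series /= !fctE -big_split -sumrB /=.
  apply: eq_bigr => i _; rewrite /b; case: (leP (a (p i)) 0) => h.
    by rewrite ler0_norm //; lra.
  by rewrite gtr0_norm //; lra.
by apply: is_cvgB => //; apply: is_cvgD.
Qed.

Lemma unbounded_tail (S : nat -> R) : (forall M, exists n, M < S n) ->
  forall M n, exists2 k, (n <= k)%N & M < S k.
Proof.
move=> Soo M n; have [k kS] := Soo (`|M| + \sum_(i < n) `|S i|).
have s0 (i : 'I_n) : 0 <= `|S i| by [].
exists k; last first.
  apply: le_lt_trans kS; apply: le_trans (ler_norm M) _.
  by rewrite lerDl sumr_ge0.
rewrite leqNgt; apply/negP => kn; move: kS; apply/negP; rewrite -leNgt.
rewrite (bigD1 (Ordinal kn)) //= addrCA; apply: le_trans (ler_norm (S k)) _.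
by rewrite lerDl addr_ge0 // sumr_ge0.
Qed.

Lemma limn_esup_unbounded (S : nat -> R) : (forall M, exists n, M < S n) ->
  limn_esup (EFin \o S) = +oo%E.
Proof.
move=> Soo; rewrite limn_esup_lim.
have -> : esups (EFin \o S) = cst +oo%E.
  apply/funext => n; apply: eq_infty => M.
  have [k nk Mk] := unbounded_tail Soo M n.
  apply: (@le_trans _ _ (S k)%:E); first by rewrite lee_fin ltW.
  by apply: ereal_sup_ubound; exists k.
exact: lim_cst.
Qed.

Lemma unbounded_oscillation a : (forall M, exists n, M < series a n) ->
  (forall M, exists n, series a n < M) -> diverges_by_oscillation a.
Proof.
move=> up down; rewrite /diverges_by_oscillation limn_esup_unbounded //.
have -> : limn_einf (EFin \o series a) = -oo%E.
  rewrite /limn_einf (@limn_esup_unbounded (fun n => - series a n)) // => M.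
  by have [n nM] := down (- M); exists n; lra.
exact: ltNye.
Qed.

End Oscillation.

(** A real that is generic for the sets D r k lists every number (r = 0) and has
    rearranged partial sums above k (r = 1) and below - k (r = 2). *)
Lemma nonmeager_to_rr'_family (R : realType) (X : set R) :
  nonmeager X -> exists2 Pi, rr'_family R Pi & (Pi #<= X)%card.
Proof.
move=> Xnm.
have /choice[f fP] : forall y : R, exists p : nat -> nat, bijective p /\
    ((forall m, exists K, m \in word (digits y K)) ->
     forall K i, (i < size (word (digits y K)))%N ->
       p i = nth 0%N (word (digits y K)) i).
  move=> y.
  have [ex|nex] := pselect (forall m, exists K, m \in word (digits y K)).
    have [||p pb pP] := chain_bijection _ _ ex; last by exists p; split.
    - by move=> K; exact: word_uniq.
    - by move=> K; rewrite digitsS -cats1; exact: word_cat.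
  by exists id; split=> //; exists id.
exists (f @` X); last exact: card_image_le.
split; first by move=> _ [y _ <-]; have [] := fP y.
move=> a l apcc _.
pose sm (s : seq bool) := \sum_(n <- word s) a n.
pose D (r k : nat) : set (seq bool) := [set s |
  if r == 0%N then k \in word s : Prop else if r == 1%N then k%:R < sm s : Prop
  else sm s < - k%:R : Prop].
have Ddense r k s : exists t, D r k (s ++ t).
  have [w uw wext] := word_free_extend s.
  rewrite /D /=; case: (r == 0%N); [|case: (r == 1%N)].
  - have [kw|kw] := boolP (k \in w).
      have /wext[t tE] : uniq (w ++ [::]) by rewrite cats0.
      by exists t; rewrite tE cats0.
    have /wext[t tE] : uniq (w ++ [:: k]) by rewrite cats1 rcons_uniq kw.
    by exists t; rewrite tE mem_cat mem_head orbT.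
  - have [u /wext[t tE] uM] := pcc_large_sum (k%:R - \sum_(n <- w) a n) apcc uw.
    by exists t; rewrite /sm tE big_cat /=; lra.
  - have [u /wext[t tE]] := pcc_large_sum (k%:R + \sum_(n <- w) a n) (pccN apcc) uw.
    by rewrite sumrN => uM; exists t; rewrite /sm tE big_cat /=; lra.
have [y [Xy yD]] : exists y, X y /\
    forall r k, (r < 3)%N -> exists K, D r k (digits y K).
  apply: contrapT => nex; apply: Xnm.
  exists (fun n => [set y | forall K, ~ D (n %% 3)%N (n %/ 3)%N (digits y K)]).
  split=> [n|y Xy]; first exact: avoid_dense_nowhere_dense.
  apply: contrapT => ny; apply: nex; exists y; split=> // r k r3.
  apply: contrapT => nK; apply: ny; exists (k * 3 + r)%N => // K.
  rewrite modnMDl modn_small // divnMDl // divn_small // addn0 => Dy.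
  by apply: nK; exists K.
have [fb /(_ (fun m => yD 0%N m isT)) fE] := fP y.
exists (f y); [by exists y|left].
have sE K : series (a \o f y) (size (word (digits y K))) = sm (digits y K).
  rewrite /series /sm /= [RHS](big_nth 0%N).
  by apply: eq_big_nat => i /andP[_ iK]; rewrite /= (fE K).
apply: unbounded_oscillation => M.
  have [K DK] := yD 1%N (Num.bound `|M|) isT.
  exists (size (word (digits y K))); rewrite sE; apply: lt_trans DK.
  by apply: le_lt_trans (ler_norm M) _; exact: archi_boundP.
have [K DK] := yD 2%N (Num.bound `|M|) isT.
exists (size (word (digits y K))); rewrite sE; apply: lt_trans DK _.
rewrite ltrNl; apply: le_lt_trans (archi_boundP (normr_ge0 M)).
by rewrite -normrN ler_norm.
Qed.

(** * The two cardinals agree *)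

Lemma setT_nonmeager (R : realType) : nonmeager [set: R].
Proof.
move=> [F [Fnd /= cover]].
have /Baire/(_ setT) : forall n, open (~` closure (F n) : set R^o) /\
    dense (~` closure (F n) : set R^o).
  move=> n; split; first by rewrite openC; exact: closed_closure.
  move=> O [z Oz] Oo; apply: contrapT => nO.
  have : interior (closure (F n)) z.
    have : nbhs z O by apply: open_nbhs_nbhs; split.
    apply: filterS => y Oy; apply: contrapT => Fy.
    by apply: nO; exists y.
  by rewrite Fnd.
move=> [||y [_ yF]]; [by exists 0|exact: openT|].
have [n _ Fny] := cover y I.
by apply: (yF n) => //; exact: subset_closure.
Qed.

Theorem theorem12 (R : realType) :
  exists (Pi : set (nat -> nat)) (X : set R),
    [/\ is_rr' R Pi, is_non_M X & Pi #= X].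
Proof.
have [X [Xnm Xleast]] := least_card_exists (@setT_nonmeager R).
have [Pi Pirr PiX] := nonmeager_to_rr'_family Xnm.
have Xle Pi' : rr'_family R Pi' -> X #<= Pi'.
  move=> /rr'_family_to_nonmeager[X' /Xleast XX' X'Pi'].
  exact: card_le_trans XX' X'Pi'.
exists Pi, X; split=> //; last by rewrite card_eq_le PiX Xle.
by split=> // Pi' /Xle; exact: card_le_trans.
Qed.
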